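(* Let $G$ be a periodic group such that (i) the set of primes dividing the orders of elements of $G$ is exactly $\{2,3\}$, and (ii) for any two elements $g,h\in G$ whose orders are at most $4$, the order of $gh$ is at most $9$. Suppose moreover that the centralizer in $G$ of every involution of $G$ is a locally cyclic $2$-group. Then $G=O_{3}(G)\rtimes C$, where $O_{3}(G)$ is an abelian subgroup of exponent at most $9$ and $C$ is a locally cyclic $2$-group acting regularly (fixed-point-freely) on $O_{3}(G)$. In particular, $G$ is locally finite.
   Context: $O_3(G)$ denotes the largest normal $3$-subgroup of $G$. ''$C$ acts regularly on $O_3(G)$'' means that every nontrivial element of $C$ fixes only the identity of $O_3(G)$ under conjugation. *)

(* Defs.v *)
From mathcomp Require Import all_boot.
From Stdlib Require Import List.
Set Implicit Arguments. Unset Strict Implicit. Unset Printing Implicit Defensive.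

Record group := Group {
  carrier :> Type;
  gmul : carrier -> carrier -> carrier;
  gone : carrier;
  ginv : carrier -> carrier;
  gmulA : forall x y z, gmul x (gmul y z) = gmul (gmul x y) z;
  gmul1 : forall x, gmul gone x = x;
  gmulV : forall x, gmul (ginv x) x = gone
}.

Section GroupDefs.
Variable G : group.
Implicit Types (x y g h : G) (H K : G -> Prop).

Local Notation "x * y" := (gmul x y).
Local Notation "1" := (gone G).

Fixpoint gpow (g : G) (n : nat) : G :=
  match n with 0 => 1 | S m => g * gpow g m end.

Definition conj (x g : G) : G := ginv g * (x * g).

Definition has_order g (n : nat) : Prop :=
  0 < n /\ gpow g n = 1 /\ forall m, 0 < m < n -> gpow g m <> 1.

Definition order_le g (k : nat) : Prop :=
  exists n, 0 < n <= k /\ gpow g n = 1.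

Definition periodic : Prop := forall g, exists n, 0 < n /\ gpow g n = 1.

Definition prime_of_elt_orders (p : nat) : Prop :=
  exists g n, has_order g n /\ p %| n.

Definition involution g : Prop := has_order g 2.

Definition subgroup H : Prop :=
  H 1 /\ (forall x y, H x -> H y -> H (x * y)) /\ (forall x, H x -> H (ginv x)).

Definition normal H : Prop :=
  subgroup H /\ forall x g, H x -> H (conj x g).

Definition centralizer (t : G) : G -> Prop := fun x => x * t = t * x.

Definition pgroup (p : nat) H : Prop :=
  forall x, H x -> exists k, gpow x (p ^ k) = 1.

Definition gen (S : G -> Prop) : G -> Prop :=
  fun x => forall K, subgroup K -> (forall y, S y -> K y) -> K x.

Definition cyclic_sub H : Prop := exists c, forall x, H x <-> gen (eq c) x.

Definition locally_cyclic H : Prop :=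
  subgroup H /\
  forall s : list G, (forall x, In x s -> H x) ->
    cyclic_sub (gen (fun y => In y s)).

Definition locally_finite : Prop :=
  forall s : list G, exists l : list G, forall x, gen (fun y => In y s) x -> In x l.

Definition is_Op (p : nat) H : Prop :=
  normal H /\ pgroup p H /\ forall K, normal K -> pgroup p K -> forall x, K x -> H x.

Definition abelian_sub H : Prop := forall x y, H x -> H y -> x * y = y * x.

Definition semidirect_decomp (O C : G -> Prop) : Prop :=
  normal O /\ subgroup C /\ (forall x, O x -> C x -> x = 1) /\
  forall g, exists o c, O o /\ C c /\ g = o * c.

Definition acts_regularly (C O : G -> Prop) : Prop :=
  forall c o, C c -> c <> 1 -> O o -> conj o c = o -> o = 1.

End GroupDefs.

(* Main.v *)
(* The product of two distinct involutions has odd order, for otherwise both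
   would commute with the involution in the cyclic group it generates and hence
   be equal to it; so this order is 3 or 9.  The key point is that every
   involution z inverts every x of order 3.  Let s be the involution of <z, z^x>
   exchanging z and z^x, and put u = x s.  Then u is a 2-element centralizing z,
   and its order is at most 8 because it is a product of elements of order 3 and
   2.  From (u s)^3 = 1 one finds that s inverts u^2 s u, which is conjugate to
   (z x)^-1 if u has order 8; so z x always has order dividing 2 or 9.  This
   applies to s in place of z, and s x is conjugate to u, so u = z and x = z s.
   Consequently A = C(x) contains all products of two involutions, every
   involution inverts A by the usual fixed-point-free argument, and A is the
   abelian group of all t s with s an involution.  Finally G = A C(t), because t
   and any of its conjugates are exchanged by an involution s, and s t is in A. *)
From Stdlib Require Import Classical_Prop.
From Stdlib Require List.
Require Import Defs.
From mathcomp Require Import all_boot.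
From mathcomp Require Import zify.
Set Implicit Arguments. Unset Strict Implicit. Unset Printing Implicit Defensive.

Declare Scope grp_scope.
Local Notation "x * y" := (gmul x y) : grp_scope.
Local Notation "1" := (gone _) : grp_scope.
Local Notation "x ^-1" := (ginv x) : grp_scope.
Local Notation "x ^+ n" := (gpow x n) : grp_scope.
Local Open Scope grp_scope.

(** * Elementary identities in a group *)

Section GroupTheory.
Variable G : group.
Implicit Types (x y z g h s t u c : G) (m n k : nat).

Lemma mulVKg x y : x^-1 * (x * y) = y.
Proof. by rewrite gmulA gmulV gmul1. Qed.

Lemma mulgI x y z : x * y = x * z -> y = z.
Proof. by move=> e; rewrite -(mulVKg x y) e mulVKg. Qed.

Lemma mulg1 x : x * 1 = x.
Proof. by apply: (@mulgI x^-1); rewrite mulVKg gmulV. Qed.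

Lemma mulgV x : x * x^-1 = 1.
Proof. by apply: (@mulgI x^-1); rewrite mulVKg mulg1. Qed.

Lemma mulKVg x y : x * (x^-1 * y) = y.
Proof. by rewrite gmulA mulgV gmul1. Qed.

Lemma invg_eq x y : x * y = 1 -> x^-1 = y.
Proof. by move=> e; apply: (@mulgI x); rewrite mulgV e. Qed.

Lemma invgK x : (x^-1)^-1 = x.
Proof. exact: invg_eq (gmulV x). Qed.

Lemma invMg x y : (x * y)^-1 = y^-1 * x^-1.
Proof. by apply: invg_eq; rewrite -gmulA mulKVg mulgV. Qed.

Lemma invg1 : (1 : G)^-1 = 1.
Proof. by apply: invg_eq; rewrite gmul1. Qed.

Lemma mulIg x y z : y * x = z * x -> y = z.
Proof.
move=> e; have := congr1 (fun w => w * x^-1) e.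
by rewrite -!gmulA mulgV !mulg1.
Qed.

End GroupTheory.

Ltac gsimp := repeat first
  [ rewrite invMg | rewrite invgK | rewrite invg1 | rewrite gmul1 | rewrite mulg1
  | rewrite gmulV | rewrite mulgV | rewrite mulVKg | rewrite mulKVg | rewrite -gmulA ].

(** * Powers, orders of elements and involutions *)

Section Powers.
Variable G : group.
Implicit Types (x y z g h s t u c : G) (m n k : nat).

Lemma gpow1 x : x ^+ 1 = x.
Proof. exact: mulg1. Qed.

Lemma gpowD x m n : x ^+ (m + n) = x ^+ m * x ^+ n.
Proof. by elim: m => [|m IH]; rewrite ?addSn /= ?gmul1 // IH gmulA. Qed.

Lemma gpow_one n : (1 : G) ^+ n = 1.
Proof. by elim: n => //= n ->; rewrite gmul1. Qed.

Lemma gpowM x m n : x ^+ (m * n)%N = (x ^+ m) ^+ n.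
Proof. by elim: n => [|n IH]; rewrite ?muln0 // mulnS gpowD IH. Qed.

Lemma gpowSr x n : x ^+ n.+1 = x ^+ n * x.
Proof. by rewrite -addn1 gpowD gpow1. Qed.

Lemma commute_gpow x y n : x * y = y * x -> x ^+ n * y = y * x ^+ n.
Proof.
move=> e; elim: n => [|n IH] /=; first by rewrite gmul1 mulg1.
by rewrite -gmulA IH !gmulA e.
Qed.

Lemma gpow_inv x n : (x^-1) ^+ n = (x ^+ n)^-1.
Proof. by elim: n => [|n IH]; rewrite ?invg1 // gpowSr /= IH invMg. Qed.

Lemma gpow_conjg g x n : (g * x * g^-1) ^+ n = g * x ^+ n * g^-1.
Proof.
elim: n => [|n IH] /=; first by gsimp.
by rewrite IH; gsimp.
Qed.

Lemma conjg_eq1 g x : g * x * g^-1 = 1 -> x = 1.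
Proof.
move=> e; apply: (@mulgI _ g); apply: (@mulIg _ g^-1).
by rewrite e mulg1 mulgV.
Qed.

Lemma gpow_dvd x m n : x ^+ m = 1 -> m %| n -> x ^+ n = 1.
Proof. by move=> e /dvdnP[k ->]; rewrite mulnC gpowM e gpow_one. Qed.

Lemma gpow_mod x m n : x ^+ m = 1 -> x ^+ (n %% m) = x ^+ n.
Proof.
move=> e; rewrite {2}(divn_eq n m) gpowD.
by rewrite (gpow_dvd e (dvdn_mull _ (dvdnn m))) gmul1.
Qed.

Lemma order_dvd x m n : has_order x m -> x ^+ n = 1 -> m %| n.
Proof.
move=> [m0 [e min]] en; apply: contraT => ndv.
case: (min (n %% m)); last by rewrite gpow_mod.
by rewrite lt0n ndv ltn_pmod.
Qed.

(** Equality in [G] is not assumed decidable, so the least exponent is reached by classical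
    descent. *)
Lemma order_exists x n : 0 < n -> x ^+ n = 1 -> exists m, has_order x m.
Proof.
elim/ltn_ind: n => n IH n0 e.
case: (classic (exists2 m, 0 < m < n & x ^+ m = 1)) => [[m /andP[m0 mn]]|no].
  exact: IH.
by exists n; split=> //; split=> // m hm em; apply: no; exists m.
Qed.

Lemma gpow_coprime x m n : coprime m n -> x ^+ m = 1 -> x ^+ n = 1 -> x = 1.
Proof.
case: m => [|m] co em en.
  by move: co; rewrite /coprime gcd0n => /eqP n1; rewrite -(gpow1 x) -n1.
have [k hk] := order_exists (ltn0Sn m) em.
have : k %| gcdn m.+1 n by rewrite dvdn_gcd !(order_dvd hk).
rewrite (eqP co) dvdn1 => /eqP k1.
by move: hk => [_ [e _]]; rewrite -(gpow1 x) -k1.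
Qed.

Lemma has_order_prime p x : prime p -> x ^+ p = 1 -> x <> 1 -> has_order x p.
Proof.
move=> pp e ne; split; first exact: prime_gt0.
split=> // m /andP[m0 mp] em; apply: ne.
apply: (@gpow_coprime x m p) => //.
by rewrite coprime_sym prime_coprime // gtnNdvd.
Qed.

Lemma has_order_quo x k n : has_order x (n * k)%N -> has_order (x ^+ k) n.
Proof.
move=> [nk0 [e min]]; move: (nk0); rewrite muln_gt0 => /andP[n0 k0].
split=> //; split; first by rewrite -gpowM mulnC.
move=> m /andP[m0 mn]; rewrite -gpowM => em.
by apply: (min (k * m)%N) => //; rewrite muln_gt0 k0 m0 mulnC ltn_pmul2r.
Qed.

Lemma involutionE t : involution t <-> t * t = 1 /\ t <> 1.
Proof.
split=> [[_ [e min]]|[e ne]].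
  split; first by rewrite -[RHS]e /= mulg1.
  by move=> e1; apply: (min 1%N) => //; rewrite gpow1.
by apply: has_order_prime => //=; rewrite mulg1.
Qed.

Lemma inv_involution t : involution t -> t^-1 = t.
Proof. by move=> /involutionE[e _]; apply: invg_eq. Qed.

Lemma involution_conjg g t : involution t -> involution (g * t * g^-1).
Proof.
move=> /involutionE[e ne]; apply/involutionE; split.
  by gsimp; rewrite (gmulA t t) e; gsimp.
by move=> /conjg_eq1.
Qed.

Lemma genI (S : G -> Prop) x : S x -> gen S x.
Proof. by move=> Sx K _; apply. Qed.

Lemma subgroup_gpow (H : G -> Prop) x n : subgroup H -> H x -> H (x ^+ n).
Proof.
move=> [H1 [HM _]] Hx; elim: n => //= n IH; exact: HM.
Qed.

Lemma centralizer_subgroup t : subgroup (centralizer t).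
Proof.
rewrite /centralizer; split; first by rewrite gmul1 mulg1.
split=> [x y ex ey|x ex]; first by rewrite -gmulA ey !gmulA ex.
by apply: (@mulgI _ x); apply: (@mulIg _ x); gsimp.
Qed.

End Powers.

(** * Involutions with locally cyclic 2-group centralizers, and their products *)

Section RegularCentralizers.
Variable G : group.
Implicit Types (x y z g h s t u c : G) (m n k : nat).
Hypothesis perG : periodic G.
Hypothesis primesG :
  forall p, prime p -> (prime_of_elt_orders G p <-> (p = 2 \/ p = 3)).
Hypothesis boundG :
  forall g h, order_le g 4 -> order_le h 4 -> order_le (g * h) 9.
Hypothesis centG : forall t, involution t ->
  locally_cyclic (centralizer t) /\ pgroup 2 (centralizer t).

Lemma orderG x : exists n, has_order x n.
Proof. by have [n [n0 e]] := perG x; exact: order_exists e. Qed.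

(** If [x ^+ n = 1] with [n > 0], the inverse of [x] is [x ^+ n.-1], a product of copies of [x]. *)
Lemma periodic_subgroup (H : G -> Prop) :
  H 1 -> (forall x y, H x -> H y -> H (x * y)) -> subgroup H.
Proof.
move=> H1 HM; split=> //; split=> // x Hx; have [n [n0 e]] := perG x.
have -> : x^-1 = x ^+ n.-1 by apply: invg_eq; rewrite -[RHS]e -(prednK n0).
by elim: n.-1 => //= k IH; apply: HM.
Qed.

Lemma gen_cycle c x : gen (eq c) x -> exists k, x = c ^+ k.
Proof.
move=> /(_ (fun y => exists k, y = c ^+ k)); apply; last first.
  by move=> _ <-; exists 1%N; rewrite gpow1.
apply: periodic_subgroup => [|_ _ [i ->] [j ->]]; first by exists 0%N.
by exists (i + j)%N; rewrite gpowD.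
Qed.

(** If a generator [c] has order [n] and [c ^+ i] is an involution, then [n] divides [2 i] but not
    [i]. Hence [n] is even, [i] is an odd multiple of [n/2], and the involution is [c ^+ n./2]. *)
Lemma cyclic_involution_uniq (H : G -> Prop) s t :
  cyclic_sub H -> H s -> H t -> involution s -> involution t -> s = t.
Proof.
move=> [c Hc] Hs Ht is_ it; have [n hn] := orderG c.
have [n0 [en _]] := hn.
have powc x : H x -> exists k, x = c ^+ k by move=> /Hc /gen_cycle.
have invc x : H x -> involution x -> x = c ^+ n./2 /\ odd n = false.
  move=> /powc[i ->] /involutionE[e ne].
  have dv : n %| i * 2 by apply: (order_dvd hn); rewrite gpowM /= mulg1.
  have nd : ~~ (n %| i) by apply/negP => d; apply: ne; apply: gpow_dvd en d.
  have nE : odd n = false.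
    apply: contraNF nd => on; rewrite -(@Gauss_dvdl n i 2) //.
    by rewrite coprime_sym coprime2n.
  have n2 : n = (n./2 * 2)%N by lia.
  split=> //; move: dv nd; rewrite {1}n2 dvdn_pmul2r // => /dvdnP[k ->].
  have kE : k = odd k + k./2 * 2 by lia.
  case: (odd k) kE => kE nd; last first.
    by case/negP: nd; apply/dvdnP; exists k./2; nia.
  have -> : (k * n./2 = n./2 + n * k./2)%N by nia.
  by rewrite gpowD gpowM en gpow_one mulg1.
have [-> _] := invc s Hs is_. by have [-> _] := invc t Ht it.
Qed.

(** Both lie in the centralizer of [t], where they generate a cyclic group, which has only one
    involution. *)
Lemma commuting_involutions s t :
  involution s -> involution t -> s * t = t * s -> s = t.
Proof.
move=> is_ it e; have [[_ lc] _] := centG it.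
have sub x : List.In x [:: s; t] -> centralizer t x.
  by case=> [<-|[<-|[]]].
apply: (cyclic_involution_uniq (lc _ sub)) => //; apply: genI; [by left|by right; left].
Qed.

Lemma half_order_involution x n k : has_order x n -> n = (2 * k)%N ->
  involution (x ^+ k).
Proof. by move=> hn e; apply: has_order_quo; rewrite -e. Qed.

Lemma inverted_gpow t x n : t * t = 1 -> t * x * t = x^-1 ->
  t * x ^+ n * t = (x ^+ n)^-1.
Proof.
move=> tt e; have tV : t^-1 = t by apply: invg_eq.
by rewrite -{2}tV -gpow_conjg tV e gpow_inv.
Qed.

Lemma involution_order_le t : involution t -> order_le t 4.
Proof. by case=> _ [e _]; exists 2. Qed.

Lemma mul_involutions9 s t : involution s -> involution t -> (s * t) ^+ 9 = 1.
Proof.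
move=> is_ it; have [ss ns] := (involutionE _).1 is_.
have [tt nt] := (involutionE _).1 it.
have [n hn] := orderG (s * t).
have [m [/andP[m0 m9] em]] :=
  boundG (involution_order_le is_) (involution_order_le it).
have n0 : 0 < n by case: hn.
have n9 : n <= 9 := leq_trans (dvdn_leq m0 (order_dvd hn em)) m9.
(* For even [n] the involution [(s * t) ^+ n./2] is inverted, hence centralized, by [s] and by [t],
   so it equals both; then [s * t = 1], against [n] being even. *)
have odd_n : odd n.
  apply: contraT => ev.
  have iw : involution ((s * t) ^+ n./2).
    by apply: (half_order_involution hn); rewrite mul2n even_halfK.
  have stV : (s * t)^-1 = t * s by rewrite invMg !inv_involution.
  have ws : s * ((s * t) ^+ n./2) * s = (s * t) ^+ n./2.
    rewrite inverted_gpow ?(inv_involution iw) // stV.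
    by rewrite -!gmulA (gmulA s s) ss gmul1.
  have wt : t * ((s * t) ^+ n./2) * t = (s * t) ^+ n./2.
    by rewrite inverted_gpow ?(inv_involution iw) // stV -!gmulA tt mulg1.
  have es : (s * t) ^+ n./2 = s.
    by apply: commuting_involutions => //; rewrite -{1}ws -!gmulA ss mulg1.
  have et : (s * t) ^+ n./2 = t.
    by apply: commuting_involutions => //; rewrite -{1}wt -!gmulA tt mulg1.
  have : n %| 1 by apply: (order_dvd hn); rewrite gpow1 -{1}es et tt.
  by rewrite dvdn1 => /eqP n1; rewrite n1 in ev.
have no p : prime p -> p %| n -> p = 2 \/ p = 3.
  by move=> pp pn; apply/(primesG pp); exists (s * t), n.
apply: (@gpow_dvd _ _ n); first by case: hn => _ [].
have n5 : n <> 5 by move=> e; case: (no 5 isT) => //; rewrite e.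
have n7 : n <> 7 by move=> e; case: (no 7 isT) => //; rewrite e.
by have [->|[->|->]] : n = 1%N \/ n = 3 \/ n = 9 by lia.
Qed.
Lemma midpoint z z' : involution z -> involution z' ->
  exists s, involution s /\ s * z * s = z'.
Proof.
move=> iz iz'; have [zz nz] := (involutionE _).1 iz.
have r9 := mul_involutions9 iz iz'; set r := z * z' in r9.
have zrz : z * r * z = r^-1.
  by rewrite /r invMg !inv_involution // !gmulA zz gmul1.
have zrz4 := inverted_gpow 4 zz zrz.
have ss : (r ^+ 4 * z) * (r ^+ 4 * z) = 1.
  by rewrite -gmulA (gmulA z) zrz4 mulgV.
(* As [z] inverts [r], conjugation by [r^4 z] sends [z] to [r^8 z], which is [r^-1 z = z'] because
   [r^9 = 1]. *)
exists (r ^+ 4 * z); split.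
  apply/involutionE; split=> // s1; apply: nz.
  have r4 : r ^+ 4 = z by apply: (@mulIg _ z); rewrite s1 zz.
  have r8 : r ^+ 8 = 1 by rewrite (gpowD r 4 4) r4 zz.
  by rewrite -r4 (gpow_coprime _ r8 r9) // gpow_one.
have conj_wz w : w * w = r^-1 -> w * z * z * (w * z) = z'.
  move=> ww; rewrite -!gmulA (gmulA z z) zz gmul1 gmulA ww /r invMg.
  by rewrite !inv_involution // -gmulA zz mulg1.
by apply: conj_wz; rewrite -gpowD; symmetry; apply: invg_eq.
Qed.

(** * Involutions invert elements of order 3 *)

Lemma centralizer_factor x z : x ^+ 3 = 1 -> involution z ->
  exists s u, [/\ involution s, x = u * s, u * z = z * u &
    [\/ u = 1, u = z, u ^+ 2 = z | u ^+ 4 = z]].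
Proof.
move=> x3 iz; have ixz : involution (x^-1 * z * x).
  by rewrite -{2}(invgK x); apply: involution_conjg.
have [s [is_ e]] := midpoint iz ixz.
have [ss _] := (involutionE _).1 is_.
exists s, (x * s).
have uz : (x * s) * z = z * (x * s).
  apply: (@mulIg _ s); apply: (@mulgI _ x^-1).
  by move: e; rewrite -!gmulA mulVKg ss mulg1.
split=> //; first by rewrite -gmulA ss mulg1.
have [_ /(_ _ uz)[k u2k]] := centG iz.
have x_le4 : order_le x 4 by exists 3.
have [m [/andP[m0 m9] um]] := boundG x_le4 (involution_order_le is_).
have [n hn] := orderG (x * s).
have n9 : n <= 9 := leq_trans (dvdn_leq m0 (order_dvd hn um)) m9.
(* The order of [x * s] is a power of 2 not exceeding 9, thus 1, 2, 4 or 8. Any involution among its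
   powers commutes with [z], hence is [z]. *)
have /(dvdn_pfactor _ _ (isT : prime 2))[j _ nj] := order_dvd hn u2k.
have uniq w : involution ((x * s) ^+ w) -> (x * s) ^+ w = z.
  by move=> iw; apply: commuting_involutions => //; apply: commute_gpow.
case: j nj => [|[|[|[|j]]]] nj; last by move: n9; rewrite nj !expnS; have := expn_gt0 2 j; lia.
- by apply: Or41; case: hn => _ []; rewrite nj gpow1.
- by apply: Or42; rewrite -[LHS]gpow1; apply: uniq; apply: half_order_involution hn _; rewrite nj.
- by apply: Or43; apply: uniq; apply: half_order_involution hn _; rewrite nj.
- by apply: Or44; apply: uniq; apply: half_order_involution hn _; rewrite nj.
Qed.

(* When u has order 8, z x is conjugate to the inverse of q = u^2 s u; since s
   inverts q, the latter is a product of two involutions. *)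
Lemma mul_involution_order3 x z : x ^+ 3 = 1 -> involution z ->
  (z * x) ^+ 2 = 1 \/ (z * x) ^+ 9 = 1.
Proof.
move=> x3 iz; have [s [u [is_ xE uz uE]]] := centralizer_factor x3 iz.
have [zz nz] := (involutionE _).1 iz.
have [ss ns] := (involutionE _).1 is_.
have sV := inv_involution is_.
have ususu w : u * (s * (u * (s * (u * w)))) = s * w.
  have <- : x ^+ 3 * (s * w) = s * w by rewrite x3 gmul1.
  by rewrite xE /= mulg1 -!gmulA (gmulA s s) ss gmul1.
case: uE => uE.
- case: ns; apply: (@gpow_coprime _ s 2 3) => //=; first by rewrite mulg1.
  by move: x3; rewrite xE uE gmul1.
- by left; rewrite xE uE /= mulg1 -!gmulA !(gmulA z z) zz !gmul1 ss.
(* Here [u^4 = 1], so [z x = u^3 s = u^-1 s] is the inverse of [s u], a conjugate of [x]. *)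
- right; apply: (@gpow_dvd _ _ 3) => //.
  have -> : z * x = (s * x * s^-1)^-1.
    rewrite xE sV -gmulA -(gmulA u) ss mulg1 invMg sV gmulA; congr (_ * s).
    have uu : u * u = z by rewrite -uE /= mulg1.
    by symmetry; apply: invg_eq; rewrite gmulA uz -gmulA uu.
  by rewrite gpow_inv gpow_conjg x3 mulg1 mulgV invg1.
pose q := u * (u * (s * u)).
have zxE : z * x = ((s * u) * q * (s * u)^-1)^-1.
  have -> : s * u * q * (s * u)^-1 = s * (u * (u * u)).
    by rewrite /q invMg sV -!gmulA mulKVg ss mulg1.
  have uuuu w : u * (u * (u * (u * w))) = z * w by rewrite -uE /= mulg1 -!gmulA.
  have zus : z * (u * s) = u * (z * s) by rewrite !gmulA uz.
  by symmetry; apply: invg_eq; rewrite xE -!gmulA zus uuuu (gmulA z) zz gmul1.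
have zx_pow n : q ^+ n = 1 -> (z * x) ^+ n = 1.
  by move=> qn; rewrite zxE gpow_inv gpow_conjg qn mulg1 mulgV invg1.
(* Two uses of [ususu = s] collapse the word [suusu suusu]. So [s * q] is trivial or an involution;
   in the first case [q = s]. *)
have sqsq : (s * q) * (s * q) = 1.
  have := ususu 1; rewrite !mulg1 => ususu1.
  by rewrite /q -!gmulA ususu ususu1 ss.
case: (classic (s * q = 1)) => [sq1|sq_ne].
  by left; apply: zx_pow; rewrite -(invg_eq sq1) sV /= mulg1.
right; apply: zx_pow.
have -> : q = s * (s * q) by rewrite gmulA ss gmul1.
by apply: mul_involutions9 => //; apply/involutionE.
Qed.
(* Apply the previous lemma to x and the midpoint s: s x is conjugate to the
   2-element u, whose order it forces to be at most 2. *)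
Lemma involution_inverts_order3 x t : x ^+ 3 = 1 -> involution t ->
  t * x * t = x^-1.
Proof.
move=> x3 it; have [s [u [is_ xE ut uE]]] := centralizer_factor x3 it.
have [tt nt] := (involutionE _).1 it.
have [ss ns] := (involutionE _).1 is_.
have sxE : s * x = s * u * s^-1 by rewrite inv_involution // xE gmulA.
(* If [u^2 = t] or [u^4 = t], either alternative would force [t = 1]; [u = 1] would make [x] an
   involution. Only [u = t] survives, and then [x = t s] is inverted by [t]. *)
have u29 : u ^+ 2 = 1 \/ u ^+ 9 = 1.
  by case: (mul_involution_order3 x3 is_); rewrite sxE gpow_conjg => /conjg_eq1; [left|right].
case: uE => uE.
- case: ns; apply: (@gpow_coprime _ s 2 3) => //=; first by rewrite mulg1.
  by move: x3; rewrite xE uE gmul1.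
- by rewrite xE uE invMg !inv_involution // !gmulA tt gmul1.
- case: nt; rewrite -uE; case: u29 => // u9.
  have u4 : u ^+ 4 = 1 by rewrite (gpowM u 2 2) uE /= mulg1.
  by rewrite (gpow_coprime _ u4 u9) // gpow_one.
case: nt; rewrite -uE; case: u29 => [u2|u9]; first exact: gpow_dvd u2 _.
have u8 : u ^+ 8 = 1 by rewrite (gpowM u 4 2) uE /= mulg1.
by rewrite (gpow_coprime _ u8 u9) // gpow_one.
Qed.

(** For odd [n], [uphalf n] is [(n+1)/2], the inverse of 2 modulo [n]. *)
Lemma odd_sqrt x n : odd n -> x ^+ n = 1 -> x ^+ uphalf n * x ^+ uphalf n = x.
Proof.
move=> on xn; rewrite -gpowD.
have -> : (uphalf n + uphalf n = n.+1)%N by lia.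
by rewrite /= xn mulg1.
Qed.

(** * The centralizer of an element of order 3 *)

Section OrderThree.
Variables (x t : G).
Hypotheses (x3 : x ^+ 3 = 1) (nx : x <> 1) (it : involution t).

Let A := centralizer x.
Let tt : t * t = 1 := ((involutionE t).1 it).1.

(** An involution among the powers of [y] would both centralize and invert [x], giving [x^2 = 1]. *)
Lemma cent_odd_order y : A y -> exists2 n, odd n & y ^+ n = 1.
Proof.
move=> Ay; have [n hn] := orderG y.
exists n; last by case: hn => _ [].
apply: contraT => ev.
have iw : involution (y ^+ n./2).
  by apply: (half_order_involution hn); rewrite mul2n even_halfK.
have [ww _] := (involutionE _).1 iw.
have xV : x = x^-1.
  rewrite -(involution_inverts_order3 x3 iw) (commute_gpow _ Ay).
  by rewrite -gmulA ww mulg1.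
case: nx; apply: (@gpow_coprime _ x 2 3) => //=.
by rewrite mulg1 {2}xV mulgV.
Qed.

(** Since [t] inverts [x], it normalizes the subgroup generated by [x], and so its centralizer. *)
Lemma cent_conj_involution y : A y -> A (t * y * t).
Proof.
rewrite /A /centralizer => Ay.
have xE : x = t * x^-1 * t.
  by rewrite -(involution_inverts_order3 x3 it) -!gmulA tt mulg1 gmulA tt gmul1.
have Ay' : y * x^-1 = x^-1 * y.
  by apply: (@mulgI _ x); apply: (@mulIg _ x); gsimp.
rewrite {1}xE -!gmulA (gmulA t t) tt gmul1 (gmulA y) Ay'.
by rewrite {2}xE -!gmulA (gmulA t t) tt gmul1.
Qed.

(* w is the square root of y^-1 y^t, so t centralizes y w, which is both a
   2-element and of odd order; hence y = w^-1. *)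
Lemma cent_inverted y : A y -> t * y * t = y^-1.
Proof.
move=> Ay; have [A1 [AM AV]] := centralizer_subgroup x.
have tV := inv_involution it.
set z := y^-1 * (t * y * t).
have Az : A z by apply: AM; [apply: AV | apply: cent_conj_involution].
have [n on zn] := cent_odd_order Az; have ww := odd_sqrt on zn.
have tzt : t * z * t = z^-1.
  by rewrite /z !invMg invgK tV -!gmulA tt mulg1.
set w := z ^+ uphalf n in ww.
have twt : t * w * t = w^-1 by apply: inverted_gpow.
have Aw : A w by apply: subgroup_gpow (centralizer_subgroup x) Az.
have fixed : t * (y * w) * t = y * w.
  have -> : t * (y * w) * t = t * y * t * (t * w * t).
    by rewrite -!gmulA (gmulA t t) tt gmul1.
  have -> : t * y * t = y * (w * w) by rewrite ww /z mulKVg.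
  by rewrite twt -!gmulA mulgV mulg1.
have Cyw : centralizer t (y * w).
  by rewrite /centralizer -{2}fixed -!gmulA (gmulA t t) tt gmul1.
have [m om ywm] := cent_odd_order (AM _ _ Ay Aw).
have [_ /(_ _ Cyw)[k ywk]] := centG it.
have yV : y^-1 = w.
  by apply/invg_eq/(gpow_coprime _ ywk ywm); rewrite coprimeXl // coprime2n.
have yE : t * y^-1 * t = y by rewrite yV twt -yV invgK.
by rewrite -{2}yE !invMg invgK tV gmulA.
Qed.

(** On [A] inversion coincides with conjugation by [t], so it is a homomorphism. *)
Lemma cent_abelian : abelian_sub A.
Proof.
move=> y z Ay Az; have [_ [AM _]] := centralizer_subgroup x.
apply: (@mulgI _ t); apply: (@mulIg _ t).
rewrite (cent_inverted (AM _ _ Ay Az)) invMg.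
rewrite -(cent_inverted Ay) -(cent_inverted Az).
by rewrite -!gmulA (gmulA t t) tt gmul1.
Qed.

Lemma mul_involutions_cent r s : involution r -> involution s -> A (r * s).
Proof.
move=> ir is_; rewrite /A /centralizer.
have [rr _] := (involutionE _).1 ir; have [ss _] := (involutionE _).1 is_.
have swap w : involution w -> w * x = x^-1 * w.
  move=> iw; have [ww _] := (involutionE _).1 iw.
  by rewrite -(involution_inverts_order3 x3 iw) -gmulA ww mulg1.
have swapV : r * x^-1 = x * r.
  by rewrite -(involution_inverts_order3 x3 ir) -!gmulA (gmulA r r) rr gmul1.
by rewrite -gmulA swap // gmulA swapV gmulA.
Qed.

(** The square is trivial because [t] inverts [y], and [t * y = 1] would give [y = t], against the
    odd order of [y]. Every [y] in [A] is thus the product of the involutions [t] and [t * y]. *)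
Lemma cent_involution_factor y : A y -> involution (t * y).
Proof.
move=> Ay; apply/involutionE; split.
  by rewrite gmulA cent_inverted // gmulV.
move=> ty1; have [n on yn] := cent_odd_order Ay.
have yt : y = t by rewrite -(inv_involution it) (invg_eq ty1).
have [_ nt] := (involutionE _).1 it; apply: nt; rewrite -yt.
apply: (@gpow_coprime _ y 2 n) => //; first by rewrite coprime2n.
by rewrite yt /= mulg1.
Qed.

Lemma cent_exp9 y : A y -> y ^+ 9 = 1.
Proof.
move=> Ay; have -> : y = t * (t * y) by rewrite gmulA tt gmul1.
exact: mul_involutions9 (cent_involution_factor Ay).
Qed.

(** [A] is the set of products of two involutions, which conjugation preserves. *)
Lemma cent_normal : normal A.
Proof.
split=> [|y g Ay]; first exact: centralizer_subgroup.
have -> : Defs.conj y g = (g^-1 * t * (g^-1)^-1) * (g^-1 * (t * y) * (g^-1)^-1).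
  by rewrite /Defs.conj invgK -!gmulA mulKVg (gmulA t t) tt gmul1.
by apply: mul_involutions_cent; apply: involution_conjg => //; apply: cent_involution_factor.
Qed.

(** A Frattini argument: an involution [s] carries [t] to [g t g^-1], so [s g] and [t s g]
    centralize [t], and [g = (s t)(t s g)]. *)
Lemma cent_factor g : exists o c, A o /\ centralizer t c /\ g = o * c.
Proof.
have [s [is_ e]] := midpoint it (involution_conjg g it).
have [ss _] := (involutionE _).1 is_.
exists (s * t), (t * (s * g)); split; first exact: mul_involutions_cent.
split; last by rewrite -gmulA (gmulA t) tt gmul1 gmulA ss gmul1.
have sgt : s * g * t = t * (s * g).
  have -> : s * g * t = s * (g * t * g^-1) * g by rewrite -!gmulA gmulV mulg1.
  by rewrite -e -!gmulA gmulA ss gmul1.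
by rewrite /centralizer -!gmulA (gmulA s) sgt.
Qed.

(** Modulo the normal subgroup [A], [y] agrees with a 2-element [c]. Then [c ^+ (3 ^ m)] lies in
    [A], which has exponent dividing 9, so [c = 1]. This gives the maximality of [A] among normal
    3-subgroups. *)
Lemma order3_pow_cent y m : y ^+ (3 ^ m) = 1 -> A y.
Proof.
move=> y3; have [o [c [Ao [Cc yE]]]] := cent_factor y.
have [[A1 [AM AV]] Aconj] := cent_normal.
have pow_y n : exists2 a, A a & y ^+ n = a * c ^+ n.
  elim: n => [|n [a Aa IH]]; first by exists 1; rewrite //= mulg1.
  exists (o * Defs.conj a c^-1); first by apply: AM => //; apply: Aconj.
  by rewrite /= IH yE /Defs.conj; gsimp.
have [a Aa ya] := pow_y (3 ^ m).
have c3 : c ^+ (3 ^ m) = a^-1.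
  by symmetry; apply: invg_eq; rewrite -ya.
have Ac : A (c ^+ (3 ^ m)) by rewrite c3; apply: AV.
have [_ /(_ _ Cc)[i ci]] := centG it.
have c1 : c = 1.
  apply: (@gpow_coprime _ c (2 ^ i) (3 ^ m * 9)) => //.
    by rewrite coprimeMr !coprimeXl //= coprimeXr.
  by rewrite gpowM cent_exp9.
by rewrite yE c1 mulg1.
Qed.

Lemma cent_disjoint y : A y -> centralizer t y -> y = 1.
Proof.
move=> Ay Cy; have [_ /(_ _ Cy)[i yi]] := centG it.
by apply: (gpow_coprime _ yi (cent_exp9 Ay)); rewrite coprimeXl.
Qed.

Lemma cent_Op : is_Op 3 A.
Proof.
split; first exact: cent_normal.
split=> [y Ay|K _ K3 y Ky]; first by exists 2; apply: cent_exp9.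
by have [m] := K3 _ Ky; apply: order3_pow_cent.
Qed.

(** A nontrivial [c] in the 2-group has an involution as a power; it commutes with [t], hence is
    [t]. A fixed point of [c] is therefore centralized by [t]. *)
Lemma cent_regular : acts_regularly (centralizer t) A.
Proof.
move=> c o Cc nc Ao co; have [_ /(_ _ Cc)[i ci]] := centG it.
have [n hn] := orderG c.
have /(dvdn_pfactor _ _ (isT : prime 2))[[|j] _ nj] := order_dvd hn ci.
  by case: nc; case: hn => _ []; rewrite nj gpow1.
have iw : involution (c ^+ (2 ^ j)).
  by apply: (half_order_involution hn); rewrite nj expnS.
apply: cent_disjoint => //.
have <- : c ^+ (2 ^ j) = t.
  by apply: commuting_involutions => //; apply: commute_gpow.
rewrite /centralizer (@commute_gpow _ c o) //.
by rewrite -{1}co /Defs.conj mulKVg.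
Qed.

Lemma cent_semidirect : semidirect_decomp A (centralizer t).
Proof.
split; first exact: cent_normal; split; first exact: centralizer_subgroup.
by split=> [y|g]; [apply: cent_disjoint | apply: cent_factor].
Qed.

End OrderThree.

(** * Local finiteness of an abelian normal subgroup extended by a locally cyclic group *)

Definition finite_pred (P : G -> Prop) :=
  exists l : list G, forall x, P x -> List.In x l.

Lemma finite_mulg (P Q : G -> Prop) : finite_pred P -> finite_pred Q ->
  finite_pred (fun x => exists p q, [/\ P p, Q q & x = p * q]).
Proof.
move=> [l Hl] [l' Hl'].
exists (List.map (fun pq => pq.1 * pq.2) (List.list_prod l l')).
move=> _ [p [q [/Hl Pp /Hl' Qq ->]]].
by apply/List.in_map_iff; exists (p, q); split=> //; apply: List.in_prod.
Qed.

Lemma finite_cycle c : finite_pred (fun x => exists k, x = c ^+ k).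
Proof.
have [n [n0 [e _]]] := orderG c.
exists (List.map (gpow c) (List.seq 0 n)) => _ [k ->].
apply/List.in_map_iff; exists (k %% n); split; first exact: gpow_mod.
by apply/List.in_seq; have := ltn_pmod k n0; lia.
Qed.

(** Ordered products of powers of the entries. When these commute, this is the subgroup they
    generate; natural exponents suffice by periodicity. *)
Fixpoint span (l : list G) : G -> Prop :=
  if l is a :: l' then
    fun x => exists p q, [/\ exists k, p = a ^+ k, span l' q & x = p * q]
  else eq 1.

Lemma finite_span l : finite_pred (span l).
Proof.
elim: l => [|a l IH] /=; first by exists [:: 1] => x <-; left.
by apply: finite_mulg => //; apply: finite_cycle.
Qed.

Lemma span1 l : span l 1.
Proof.
elim: l => //= a l IH; exists 1, 1; split=> //; last by rewrite gmul1.
by exists 0%N.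
Qed.

Lemma span_mem l x : List.In x l -> span l x.
Proof.
elim: l => //= a l IH [->|/IH lx].
  exists x, 1; split; [by exists 1%N; rewrite gpow1 | exact: span1 | by rewrite mulg1].
by exists 1, x; split=> //; [exists 0%N | rewrite gmul1].
Qed.

Section AbelianByCyclic.
Variable A : G -> Prop.
Hypotheses (normA : normal A) (abA : abelian_sub A).

Lemma span_sub l : (forall a, List.In a l -> A a) -> forall x, span l x -> A x.
Proof.
have [sA _] := normA; have [A1 [AM _]] := sA.
elim: l => [|a l IH] lA x /=; first by move=> <-.
move=> [p [q [[k ->] lq ->]]]; apply: AM.
  by apply: subgroup_gpow => //; apply: lA; left.
by apply: IH lq => b lb; apply: lA; right.
Qed.

Lemma span_mul l : (forall a, List.In a l -> A a) ->
  forall x y, span l x -> span l y -> span l (x * y).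
Proof.
have [sA _] := normA.
elim: l => [|a l IH] lA x y /=; first by move=> <- <-; rewrite gmul1.
have Aa : A a by apply: lA; left.
have lA' b : List.In b l -> A b by move=> lb; apply: lA; right.
move=> [_ [q [[i ->] lq ->]]] [_ [q' [[j ->] lq' ->]]].
exists (a ^+ (i + j)), (q * q'); split; [by exists (i + j)%N | exact: IH |].
rewrite gpowD -!gmulA; congr (_ * _).
rewrite !gmulA; congr (_ * _); apply: abA; first exact: span_sub lq.
exact: subgroup_gpow.
Qed.

Lemma span_conj c l : (forall a, List.In a l -> A a) ->
  (forall a, List.In a l -> List.In (c * a * c^-1) l) ->
  forall x, span l x -> span l (c * x * c^-1).
Proof.
move=> lA lc.
(* The list [l] closed under conjugation stays fixed as the target, while the induction runs on the
   source [l']. *)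
suff sub l' : (forall a, List.In a l' -> List.In (c * a * c^-1) l) ->
    forall x, span l' x -> span l (c * x * c^-1) by apply: sub.
elim: l' => [|a l' IH] l'c x /=; first by move=> <-; rewrite mulg1 mulgV; apply: span1.
move=> [_ [q [[i ->] lq ->]]].
have -> : c * (a ^+ i * q) * c^-1 = (c * a * c^-1) ^+ i * (c * q * c^-1).
  by rewrite gpow_conjg; gsimp.
apply: span_mul => //; last by apply: IH lq => b lb; apply: l'c; right.
elim: i => [|i IHi] /=; first exact: span1.
by apply: span_mul => //; apply: span_mem; apply: l'c; left.
Qed.

(** Closing [l] under conjugation by the finitely many powers of [c] gives [l'], whose span is
    finite and normalized by [c]. Its product with the cyclic group of [c] is a finite subgroup
    containing all the generators. *)
Lemma gen_abelian_cycle_finite l c : (forall a, List.In a l -> A a) ->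
  finite_pred (gen (fun g => exists a k, List.In a l /\ g = a * c ^+ k)).
Proof.
move=> lA; have [_ conjA] := normA; have [n [n0 [cn _]]] := orderG c.
pose l' := List.flat_map
  (fun a => List.map (fun j => c ^+ j * a * (c ^+ j)^-1) (List.seq 0 n)) l.
have l'E x : List.In x l' <->
    exists a j, List.In a l /\ x = c ^+ j * a * (c ^+ j)^-1.
  rewrite List.in_flat_map; split=> [[a [la /List.in_map_iff[j [<- _]]]]|].
    by exists a, j.
  move=> [a [j [la ->]]]; exists a; split=> //; apply/List.in_map_iff.
  exists (j %% n); rewrite gpow_mod //; split=> //.
  by apply/List.in_seq; have := ltn_pmod j n0; lia.
have l'A a : List.In a l' -> A a.
  move=> /l'E[b [j [/lA Ab ->]]]; have := conjA _ (c ^+ j)^-1 Ab.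
  by rewrite /Defs.conj invgK gmulA.
have l'c a : List.In a l' -> List.In (c * a * c^-1) l'.
  move=> /l'E[b [j [lb ->]]]; apply/l'E; exists b, j.+1; split=> //=.
  by gsimp.
have l'ck k x : span l' x -> span l' (c ^+ k * x * (c ^+ k)^-1).
  move=> lx; elim: k => [|k IH]; first by rewrite /= gmul1 invg1 mulg1.
  have -> : c ^+ k.+1 * x * (c ^+ k.+1)^-1 = c * (c ^+ k * x * (c ^+ k)^-1) * c^-1.
    by rewrite /=; gsimp.
  exact: span_conj.
have [m Hm] := finite_mulg (finite_span l') (finite_cycle c).
exists m => x gx; apply: Hm; move: x gx.
pose T x := exists p q, [/\ span l' p, exists k, q = c ^+ k & x = p * q].
suff [sT lT] : subgroup T /\ forall a k, List.In a l -> T (a * c ^+ k).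
  by move=> x /(_ T); apply=> // _ [a [k [la ->]]]; apply: lT.
split; last first.
  move=> a k la; exists a, (c ^+ k); split=> //; last by exists k.
  apply: span_mem; apply/l'E; exists a, 0%N; split=> //=.
  by rewrite gmul1 invg1 mulg1.
apply: periodic_subgroup.
  by exists 1, 1; split; [exact: span1 | exists 0%N | rewrite gmul1].
move=> _ _ [p [_ [lp [i ->] ->]]] [p' [_ [lp' [j ->] ->]]].
exists (p * (c ^+ i * p' * (c ^+ i)^-1)), (c ^+ (i + j)).
split; [by apply: span_mul => //; apply: l'ck | by exists (i + j)%N |].
by rewrite gpowD; gsimp.
Qed.

(** The finitely many [C]-parts of the given elements generate a cyclic group, so these elements
    have the form [o * c ^+ k] with one common [c]. *)
Lemma abelian_by_locally_cyclic_locally_finite (C : G -> Prop) :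
  locally_cyclic C -> (forall g, exists o c, A o /\ C c /\ g = o * c) ->
  locally_finite G.
Proof.
move=> [_ cyC] dec s.
have [os [cs [osA csC sE]]] : exists os cs,
    [/\ forall o, List.In o os -> A o, forall c, List.In c cs -> C c &
      forall g, List.In g s ->
        exists o c, [/\ List.In o os, List.In c cs & g = o * c]].
  elim: s => [|g s [os [cs [osA csC IH]]]]; first by exists [::], [::].
  have [o [c [Ao [Cc gE]]]] := dec g.
  exists (o :: os), (c :: cs).
  split=> [o' /= [<-//|/osA//]|c' /= [<-//|/csC//]|h /= [<-|hs]].
  - by exists o, c; split=> //; left.
  - by have [o' [c' [ho hc hE]]] := IH h hs; exists o', c'; split=> //; right.
have [c cE] := cyC cs csC.
have [l Hl] := gen_abelian_cycle_finite c osA.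
exists l => x gx; apply: Hl => K sK SK; apply: gx => // g /sE[o [d [oo dd gE]]].
have /cE/gen_cycle[k dE] : gen (fun y => List.In y cs) d by apply: genI.
by apply: SK; exists o, k; rewrite gE dE.
Qed.

End AbelianByCyclic.

(** * Elements of orders 2 and 3, and assembly of the decomposition *)

Lemma order_prime_exists p : prime p -> p = 2 \/ p = 3 ->
  exists x, has_order x p.
Proof.
move=> pp /(primesG pp)[g [n [hn /dvdnP[k nE]]]].
by exists (g ^+ k); apply: has_order_quo; rewrite mulnC -nE.
Qed.

End RegularCentralizers.

Local Close Scope grp_scope.

Theorem theorem1 (G : group) :
  periodic G ->
  (forall p : nat, prime p -> (prime_of_elt_orders G p <-> (p = 2 \/ p = 3))) ->
  (forall g h : G, order_le g 4 -> order_le h 4 -> order_le (gmul g h) 9) ->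
  (forall t : G, involution t ->
     locally_cyclic (centralizer t) /\ pgroup 2 (centralizer t)) ->
  (exists (O C : G -> Prop),
     is_Op 3 O /\ semidirect_decomp O C /\
     abelian_sub O /\ (forall x : G, O x -> gpow x 9 = gone G) /\
     locally_cyclic C /\ pgroup 2 C /\ acts_regularly C O)
  /\ locally_finite G.
Proof.
move=> perG primesG boundG centG.
have [t it] := order_prime_exists primesG (isT : prime 2) (or_introl erefl).
have [x hx] := order_prime_exists primesG (isT : prime 3) (or_intror erefl).
have x3 : gpow x 3 = gone G by case: hx => _ [].
have nx : x <> gone G.
  by move=> x1; case: hx => _ [_ /(_ 1%N isT)]; rewrite gpow1.
have [lcC C2] := centG t it.
have abA := cent_abelian perG primesG boundG centG x3 nx it.
split.
  (* Any [x] of order 3 and any involution [t] serve: the centralizer of [x] is the largest normal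
     3-subgroup, and that of [t] is a complement. *)
  exists (centralizer x), (centralizer t).
  split; first exact: (cent_Op perG primesG boundG centG x3 nx it).
  split; first exact: (cent_semidirect perG primesG boundG centG x3 nx it).
  split=> //; split; first exact: (cent_exp9 perG primesG boundG centG x3 nx it).
  by split=> //; split=> //; apply: (cent_regular perG primesG boundG centG x3 nx it).
apply: (abelian_by_locally_cyclic_locally_finite perG _ abA lcC).
  exact: (cent_normal perG primesG boundG centG x3 nx it).
exact: (cent_factor perG primesG boundG centG x3 it).
Qed.
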